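(* Let $\theta\in[0,1]$ and let $Y$ be a real random variable with Gaussian-mixture CDF $F_Y(x)=\sum_{l=1}^{N_l}a_l\Phi\big(\frac{x-\mu_l}{\sigma_l}\big)$, where $a_l\ge0$, $\sum_l a_l=1$, $\sigma_l>0$, and let $\mu=\sum_l a_l\mu_l$ and $\sigma^2$ be the mean and variance of $Y$. Let $X\sim\mathrm{Bernoulli}(\theta)$ be independent of $Y$, set $\varepsilon=XY$ and $\sigma_\varepsilon^2=\theta\sigma^2+(1-\theta)\theta\mu^2$, and for an integer $M\ge1$ let $\bar\varepsilon\sim\mathcal N(\theta\mu,\sigma_\varepsilon^2/M)$. Then $$R(\varepsilon,\bar\varepsilon)\le(1-\theta)\mathbb E[|Y|]+\sum_{l=1}^{N_l}a_l\Big(|\theta\mu-\mu_l|+\Big|\frac{\sigma_\varepsilon}{\sqrt M}-\sigma_l\Big|\Big),$$ where $\mathbb E[|Y|]\le\sum_{l=1}^{N_l}\Big\{\sqrt{\tfrac{2}{\pi}}\,\sigma_l\exp\big(\tfrac{-\mu_l^2}{2\sigma_l^2}\big)+\mu_l\big[1-2\Phi\big(\tfrac{-\mu_l}{\sigma_l}\big)\big]\Big\}$.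
   Context: $\Phi$ is the CDF of the standard normal distribution and $\mathcal N(m,s^2)$ the normal distribution with mean $m$ and variance $s^2$. For real random variables $\xi,\eta$ with CDFs $F,G$, $R(\xi,\eta)=\int_{-\infty}^{\infty}|F(x)-G(x)|\,dx$ is the (1-)Wasserstein distance between their distributions. (In the paper, $\varepsilon$ models a misbehaving node's error and $\bar\varepsilon$ the central-limit Gaussian model of the average of $M$ detected errors used for compensation.) *)

(* Defs.v *)
From HB Require Import structures.
From mathcomp Require Import all_boot all_order all_algebra.
From mathcomp Require Import all_classical all_reals all_analysis.
Set Implicit Arguments. Unset Strict Implicit. Unset Printing Implicit Defensive.
Import Order.TTheory GRing.Theory Num.Theory.
Local Open Scope classical_set_scope.
Local Open Scope ring_scope.

Definition Phi {R : realType} (x : R) : R :=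
  fine (normal_prob 0 1 `]-oo, x]).

(* CDF of N(m, s^2), with s >= 0 the standard deviation.  For s = 0 this is
   the degenerate normal law (Dirac mass at m). *)
Definition gauss_cdf {R : realType} (m s : R) (x : R) : R :=
  if 0 < s then Phi ((x - m) / s) else (if m <= x then 1 else 0).

Definition cdf_of {d} {T : measurableType d} {R : realType}
  (P : probability T R) (Z : T -> R) (x : R) : R :=
  fine (P (Z @^-1` `]-oo, x])).

Definition wasserstein1 {R : realType} (F G : R -> R) : \bar R :=
  (\int[@lebesgue_measure R]_x (`|F x - G x|)%:E)%E.

(* Main.v *)
Require Import Defs.
From HB Require Import structures.
From mathcomp Require Import all_boot all_order all_algebra.
From mathcomp Require Import all_classical all_reals all_analysis.
From mathcomp Require Import measurable_realfun ring lra.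
Import Order.TTheory GRing.Theory Num.Theory.
Import numFieldNormedType.Exports.
Local Open Scope classical_set_scope.
Local Open Scope ring_scope.
Set Implicit Arguments.
Unset Strict Implicit.
Unset Printing Implicit Defensive.

(** Tonelli's theorem applied to the events [U <= x] and [V <= x] shows that the
    Wasserstein distance between the distribution functions of [U] and [V] is at
    most [E|U - V|], with equality when [V] is constant.  The distribution
    function of [X Y] is [theta F_Y + (1 - theta) H] with [H] the Heaviside
    function, so its distance to [F_Y] is [(1 - theta)] times the distance
    between [F_Y] and [H], which is [E|Y|].  Convexity of the distance reduces
    the distance between [F_Y] and the Gaussian to each mixture component;
    coupling [m + s Z] with [m' + s' Z], for [Z] standard normal, bounds it by
    [|m - m'| + |s - s'| E|Z|], and [E|Z| <= 1].  Convexity also bounds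
    [E|Y|] by the weighted sum of the first absolute moments of the components;
    the weights are at most [1] and can be dropped. *)

(** * Wasserstein distance and couplings *)

Lemma integral_addb_le {R : realType} (u v : R) :
  (\int[@lebesgue_measure R]_x ((u <= x) (+) (v <= x))%:R%:E = `|u - v|%:E)%E.
Proof.
wlog uv : u v / u <= v.
  move=> H; have [/H//|/ltW/H] := leP u v.
  by rewrite distrC => <-; apply: eq_integral => x _; rewrite addbC.
(* For [u <= v], exactly one of the two comparisons holds precisely when [x] lies in [[u, v[], so
   the integral is the length of that interval. *)
transitivity (\int[@lebesgue_measure R]_x (\1_`[u, v[ x)%:E)%E.
  apply: eq_integral => x _; rewrite indicE; congr (_%:R%:E).
  rewrite mem_setE in_itv/=.
  have [vx|] := leP v x; last by rewrite andbT addbF.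
  by rewrite (le_trans uv vx).
rewrite integral_indic//= setIT lebesgue_measure_itv/= lte_fin.
rewrite distrC ger0_norm ?subr_ge0//.
by have [//|vu] := ltP u v; rewrite (@le_anti _ _ u v) ?uv// subrr.
Qed.

Lemma measurable_integrand_wasserstein (R : realType) (F G : R -> R) :
  measurable_fun setT F -> measurable_fun setT G ->
  measurable_fun setT (fun x => `|F x - G x|%:E).
Proof.
move=> mF mG; apply/measurable_EFinP; apply: measurableT_comp => //.
exact: measurable_funB.
Qed.

Section cdf.
Context d (T : measurableType d) (R : realType) (P : probability T R).
Implicit Types U V : T -> R.
Local Notation mu := (@lebesgue_measure R).

Lemma cdf_of_cst (c x : R) : cdf_of P (cst c) x = (c <= x)%R%:R.
Proof.
rewrite /cdf_of preimage_cst mem_setE in_itv/=.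
by case: (c <= x); rewrite ?probability_setT ?measure0.
Qed.

Lemma measurable_preimage_itvNyc U x : measurable_fun setT U ->
  measurable (U @^-1` `]-oo, x]).
Proof. by move=> mU; rewrite -[X in measurable X]setTI; exact: mU. Qed.

Lemma measurable_cdf_of U : measurable_fun setT U ->
  measurable_fun setT (cdf_of P U).
Proof.
move=> mU; apply: nondecreasing_measurable => //= x y xy.
rewrite /cdf_of fine_le ?fin_num_measure//;
  try exact: measurable_preimage_itvNyc.
rewrite le_measure ?inE//; try exact: measurable_preimage_itvNyc.
by move=> w; rewrite /= !in_itv/= => /le_trans; exact.
Qed.

Let sub_le U x := U @^-1` `]-oo, x].

Let measurable_symdiff U V : measurable_fun setT U -> measurable_fun setT V ->
  measurable [set z : T * R | (sub_le U z.2 `+` sub_le V z.2) z.1].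
Proof.
move=> mU mV.
have m W : measurable_fun setT W ->
    measurable [set z : T * R | sub_le W z.2 z.1].
  move=> mW.
  have := @measurable_fun_ler _ _ _ setT (fun z : T * R => W z.1) snd.
  move=> /(_ (measurableT_comp mW measurable_fst) measurable_snd).
  by move=> /(_ measurableT [set true]); rewrite setTI preimage_true; exact.
by apply: measurableU; apply: measurableD; exact: m.
Qed.

(** Both sides integrate the indicator of the pairs [(w, x)] for which exactly one of [U w <= x],
    [V w <= x] holds: over [w] first on the left, over [x] first on the right, where
    [integral_addb_le] evaluates the inner integral. *)
Let integral_symdiff U V : measurable_fun setT U -> measurable_fun setT V ->
  (\int[mu]_x P (sub_le U x `+` sub_le V x) = \int[P]_w `|U w - V w|%:E)%E.
Proof.
move=> mU mV; have mS := measurable_symdiff mU mV.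
pose f z : \bar R := (\1_[set z | (sub_le U z.2 `+` sub_le V z.2) z.1] z)%:E.
have mf : measurable_fun setT f by apply/measurable_EFinP;
  exact: measurable_indic.
have fE w x : f (w, x) = ((U w <= x) (+) (V w <= x))%:R%:E.
  rewrite /f indicE; congr ((nat_of_bool _)%:R%:E).
  rewrite /sub_le/=; apply/idP/idP; rewrite inE/= !in_itv/=.
    by case: (U w <= x); case: (V w <= x) => //; tauto.
  by case: (U w <= x); case: (V w <= x) => //= _; [left|right]; split.
under [RHS]eq_integral do rewrite -integral_addb_le.
under [RHS]eq_integral do under eq_integral do rewrite -fE.
rewrite (@fubini_tonelli _ _ _ _ _ P mu f mf) => [|z]; last by rewrite lee_fin.
apply: eq_integral => x _.
rewrite /f integral_indic//=.
  by rewrite setIT.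
by have := measurable_ysection x mS; rewrite /ysection;
  under eq_set do rewrite inE/=.
Qed.

(** The mass of the intersection cancels in the difference, which leaves [P (A \ B) - P (B \ A)];
    its absolute value is at most the sum of the two. *)
Let abs_cdf_of U V x : measurable_fun setT U -> measurable_fun setT V ->
  (`|cdf_of P U x - cdf_of P V x|%:E <= P (sub_le U x `+` sub_le V x))%E.
Proof.
move=> mU mV; rewrite /cdf_of -!/(sub_le _ _).
have mA : measurable (sub_le U x) by exact: measurable_preimage_itvNyc.
have mB : measurable (sub_le V x) by exact: measurable_preimage_itvNyc.
move: (sub_le U x) (sub_le V x) mA mB => A B mA mB.
have -> : P (A `+` B) = (P (A `\` B) + P (B `\` A))%E.
  apply: measureU; [exact: measurableD|exact: measurableD|].
  by apply/seteqP; split => // w [[_ nBw] [Bw _]]; exact: nBw.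
have -> : P A = (P (A `\` B) + P (A `&` B))%E by exact: measureDI.
have -> : P B = (P (B `\` A) + P (A `&` B))%E by rewrite setIC;
  exact: measureDI.
have f C : measurable C -> P C = (fine (P C))%:E.
  by move=> mC; rewrite fineK// fin_num_measure.
rewrite (f _ (measurableD mA mB)) (f _ (measurableD mB mA)) (f _
  (measurableI _ _ mA mB)).
rewrite -!EFinD/= lee_fin opprD addrACA subrr addr0.
by rewrite (le_trans (ler_normB _ _))// !ger0_norm// fine_ge0.
Qed.

Lemma wasserstein1_coupling U V :
  measurable_fun setT U -> measurable_fun setT V ->
  (wasserstein1 (cdf_of P U) (cdf_of P V) <= \int[P]_w `|U w - V w|%:E)%E.
Proof.
move=> mU mV; rewrite -integral_symdiff//; apply: ge0_le_integral => //=.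
- exact: (measurable_integrand_wasserstein (measurable_cdf_of mU)
    (measurable_cdf_of mV)).
- have := measurable_fun_ysection P (measurable_symdiff mU mV).
  rewrite (_ : _ \o _ = fun x => P (sub_le U x `+` sub_le V x))//.
  by apply/funext => x /=; rewrite /ysection; under eq_set do rewrite inE/=.
- by move=> x _; exact: abs_cdf_of.
Qed.

(** The sublevel sets of a constant are empty or full, so one of the two set differences is always
    empty and the triangle inequality of [abs_cdf_of] loses nothing. *)
Lemma wasserstein1_cst U (c : R) : measurable_fun setT U ->
  wasserstein1 (cdf_of P U) (cdf_of P (cst c)) = (\int[P]_w `|U w - c|%:E)%E.
Proof.
move=> mU; rewrite -(integral_symdiff mU (@measurable_cst _ _ _ _ _ c)).
apply: eq_integral => x _;
  rewrite cdf_of_cst {2}/sub_le preimage_cst mem_setE in_itv/=.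
have mA : measurable (sub_le U x) by exact: measurable_preimage_itvNyc.
have f C : measurable C -> P C = (fine (P C))%:E.
  by move=> mC; rewrite fineK// fin_num_measure.
case: (c <= x); rewrite ?setYTC ?setY0.
  rewrite probability_setC//
    (f _ mA) -EFinB -/(sub_le U x) /cdf_of distrC ger0_norm//.
  by rewrite subr_ge0 -lee_fin -f// probability_le1.
by rewrite subr0 ger0_norm ?fine_ge0// -f.
Qed.

End cdf.

(** * Convexity and triangle inequality for the distance *)

Lemma wasserstein1_mixture (R : realType) n (a : 'I_n -> R) (F :
  'I_n -> R -> R) G :
  (forall i, 0 <= a i) -> \sum_(i < n) a i = 1 ->
  (forall i, measurable_fun setT (F i)) -> measurable_fun setT G ->
  (wasserstein1 (fun x => \sum_(i < n) a i * F i x)%R G <=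
    \sum_(i < n) (a i)%:E * wasserstein1 (F i) G)%E.
Proof.
move=> a0 a1 mF mG.
under eq_bigr => i _.
  rewrite /wasserstein1 -ge0_integralZl//; last 2 first.
  - exact: measurable_integrand_wasserstein.
  - by rewrite lee_fin.
  over.
rewrite -ge0_integral_sum//; last 2 first.
- move=> i; apply: emeasurable_funM => //;
    exact: measurable_integrand_wasserstein.
- by move=> i x _; rewrite mule_ge0// lee_fin.
apply: ge0_le_integral => //=.
- apply: measurable_integrand_wasserstein => //.
  by apply: measurable_sum => i; exact: measurable_funM.
- apply: emeasurable_sum => i; apply: emeasurable_funM => //.
  exact: measurable_integrand_wasserstein.
- move=> x _; rewrite (_ : (\sum_(i < n) _)%R =
    (\sum_(i < n) a i * `|F i x - G x|)%:E); last by rewrite -sumEFin.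
  rewrite lee_fin.
  (* As the weights sum to one, [G x] is itself the mixture of [n] copies of [G x], and the
     difference can be taken term by term. *)
  rewrite -{1}[G x]mul1r -a1 mulr_suml -sumrB (le_trans (ler_norm_sum _ _ _))//.
  by apply: ler_sum => i _; rewrite -mulrBr normrM ger0_norm.
Qed.

Lemma wasserstein1_triangle (R : realType) (F G H : R -> R) :
  measurable_fun setT F -> measurable_fun setT G -> measurable_fun setT H ->
  (wasserstein1 F H <= wasserstein1 F G + wasserstein1 G H)%E.
Proof.
move=> mF mG mH.
rewrite /wasserstein1 -ge0_integralD//;
  try exact: measurable_integrand_wasserstein.
apply: ge0_le_integral => //=.
- exact: measurable_integrand_wasserstein.
- by apply: emeasurable_funD; exact: measurable_integrand_wasserstein.
- by move=> x _; rewrite -EFinD lee_fin ler_distD.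
Qed.

(** Supplies the endpoint condition on the antiderivative in the fundamental theorem of calculus on
    [[c, +oo[]. *)
Lemma is_derive_cvg_at_right (R : realType) (F : R -> R) (c l : R) :
  is_derive c 1 F l ->
  F x @[x --> c^'+] --> F c.
Proof.
move=> dF; apply: cvg_at_right_filter.
exact/differentiable_continuous/derivable1_diffP.
Qed.

(** * The standard normal law: its CDF, its absolute moments, and Gaussian couplings *)

Section standard_normal.
Context {R : realType}.
Local Notation mu := (@lebesgue_measure R).
Local Notation phi := (@normal_pdf R 0 1).
Local Notation nu := (@normal_prob R 0 1).
Implicit Types x c m s : R.

Lemma normal_pdf01E x : phi x = (Num.sqrt (2 * pi))^-1 * expR (- (x ^+ 2 / 2)).
Proof.
rewrite normal_pdfE ?oner_eq0// /normal_peak /normal_fun subr0 expr1n mul1r.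
by rewrite mulNr -[pi *+ 2]mulr_natl.
Qed.

Lemma normal_pdf01N x : phi (- x) = phi x.
Proof. by rewrite !normal_pdf01E sqrrN. Qed.

Lemma is_derive_normal_pdf01 x : is_derive x 1 phi (- (x * phi x)).
Proof.
have -> : phi = (fun y => (Num.sqrt (2 * pi))^-1 * expR (- (y ^+ 2 / 2))).
  by apply/funext => y; exact: normal_pdf01E.
apply: is_derive_eq.
rewrite /GRing.scale/=.
by set k := _^-1; set e := expR _; field.
Qed.

Lemma cvg_normal_pdf01 : phi x @[x --> +oo] --> (0 : R).
Proof.
have -> : phi = (fun y => (Num.sqrt (2 * pi))^-1 * expR (- (y ^+ 2 / 2))).
  by apply/funext => y; exact: normal_pdf01E.
rewrite -[X in _ --> X](mulr0 (Num.sqrt (2 * pi))^-1).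
apply: cvgMr.
apply: (cvg_comp (fun x => x ^+ 2 / 2) (fun x => expR (- x)));
  last exact: cvgr_expR.
by apply: gt0_cvgMly; [rewrite invr_gt0|exact: cvgr_expr2].
Qed.

Lemma PhiE x : (Phi x)%:E = nu `]-oo, x].
Proof. by rewrite /Phi fineK// fin_num_measure. Qed.

Lemma cvg_Phi : Phi x @[x --> +oo] --> (1 : R).
Proof.
have m : measurable_fun setT (idfun : measurableTypeR R -> R)
  by exact: measurable_id.
(* The identity, seen as a random variable under [nu], has [Phi] as its CDF, so the general limit of
   a CDF at infinity applies. *)
pose h := isMeasurableFun.Build _ _ _ _ (idfun : measurableTypeR R -> R) m.
pose X : {RV nu >-> R} := HB.pack (idfun : measurableTypeR R -> R) h.
by have /fine_cvgP[_] := cvg_cdfy1 X.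
Qed.

Lemma is_derive_Phi x : is_derive x 1 Phi (phi x).
Proof.
(* The bound [x + 1] only serves to make [x] an interior point of the interval of integration. *)
have [] := @continuous_FTC1 R phi -oo%O x (x + 1).
- by rewrite ltrDl.
- by apply: integrableS (integrable_normal_pdf 0 1).
- by rewrite ltNyr.
- by apply: continuous_normal_pdf; rewrite oner_eq0.
by move=> d e; apply: DeriveDef => //; rewrite -derive1E.
Qed.

(** The Radon-Nikodym derivative of [nu] and the density [phi] have the same integral over every
    measurable set, hence agree almost everywhere. *)
Lemma integral_normal_prob01 (f : R -> \bar R) : (forall x, 0 <= f x)%E ->
  measurable_fun setT f ->
  (\int[nu]_x f x = \int[mu]_x (f x * (phi x)%:E))%E.
Proof.
move=> f0 mf; have dom : nu `<< mu by exact: normal_prob_dominates.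
rewrite -(@Radon_Nikodym_SigmaFinite.change_of_variables _ _ _ nu mu)//.
have intD := Radon_Nikodym_SigmaFinite.f_integrable dom.
have mphi : measurable_fun setT (EFin \o phi).
  by apply/measurable_EFinP; exact: measurable_normal_pdf.
apply: ae_eq_integral => //.
- by apply: emeasurable_funM => //; exact: measurable_int intD.
- by apply: emeasurable_funM.
- apply: ae_eqe_mul2l; apply: integral_ae_eq => // A _ mA.
  by rewrite -Radon_Nikodym_SigmaFinite.f_integral.
Qed.

Let continuous_phi : continuous phi.
Proof. by apply: continuous_normal_pdf; rewrite oner_eq0. Qed.

Lemma integral_normal_pdf01_tail c :
  (\int[mu]_(x in `[c, +oo[) (phi x)%:E = (1 - Phi c)%:E)%E.
Proof.
rewrite (@ge0_continuous_FTC2y _ phi Phi c 1).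
- by rewrite EFinB.
- by move=> x _; exact: normal_pdf_ge0.
- exact/continuous_subspaceT/continuous_phi.
- exact: cvg_Phi.
- by move=> x _; have [] := is_derive_Phi x.
- exact: is_derive_cvg_at_right (is_derive_Phi c).
- by move=> x _; rewrite derive1E; have := is_derive_Phi x => ?;
    exact: derive_val.
Qed.

(** The reflection [x -> - x] preserves [phi] and carries the left tail at [- c] to the right tail
    at [c]. *)
Lemma PhiN c : Phi (- c) = 1 - Phi c.
Proof.
apply: EFin_inj; rewrite -integral_normal_pdf01_tail PhiE.
rewrite /normal_prob ge0_integration_by_substitutionNy.
- by apply: eq_integral => x _; rewrite /= normal_pdf01N.
- exact/continuous_subspaceT/continuous_phi.
- by move=> x _; exact: normal_pdf_ge0.
Qed.

Let continuous_pos_part c : continuous (fun x => (x - c) * phi x).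
Proof.
move=> x; apply: cvgM; last exact: continuous_phi.
by apply: cvgB; [exact: cvg_id|exact: cvg_cst].
Qed.

Lemma integral_normal_pdf01_pos_part c :
  (\int[mu]_(x in `[c, +oo[) ((x - c) * phi x)%:E =
    (phi c - c * (1 - Phi c))%:E)%E.
Proof.
(* An antiderivative of [(x - c) * phi x], because the derivative of [phi] is [- x * phi x]; it
   tends to [- c] at infinity. *)
pose F x := - phi x - c * Phi x.
have dF x : is_derive x 1 F ((x - c) * phi x).
  have := is_derive_Phi x; have := is_derive_normal_pdf01 x => ? ?.
  by apply: is_derive_eq; rewrite /GRing.scale/=; ring.
rewrite (@ge0_continuous_FTC2y _ (fun x => (x - c) * phi x) F c (- c)).
- by rewrite -EFinB /F; congr EFin; ring.
- by move=> x cx; rewrite mulr_ge0 ?subr_ge0 ?normal_pdf_ge0.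
- exact/continuous_subspaceT/continuous_pos_part.
- rewrite -[X in _ --> X](_ : - 0 - c * 1 = - c);
    last by rewrite oppr0 add0r mulr1.
  apply: cvgB; first by apply: cvgN; exact: cvg_normal_pdf01.
  by apply: cvgMr; exact: cvg_Phi.
- by move=> x _; have [] := dF x.
- exact: is_derive_cvg_at_right (dF c).
- by move=> x _; rewrite derive1E; have := dF x => ?; exact: derive_val.
Qed.

(** The line is split at [c]. The right half is [integral_normal_pdf01_pos_part] at [c]; reflection
    turns the left half into the same integral at [- c]. *)
Lemma integral_normal_prob01_dist c :
  (\int[nu]_x `|x - c|%:E = (2 * phi c + c * (2 * Phi c - 1))%:E)%E.
Proof.
have mdist : measurable_fun setT (fun x => `|x - c|%:E).
  by apply/measurable_EFinP; apply: measurableT_comp => //;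
    exact: measurable_funB.
rewrite integral_normal_prob01//.
have mf : measurable_fun setT (fun x : R => (`|x - c| * phi x)%:E).
  under eq_fun do rewrite EFinM.
  apply: emeasurable_funM => //; apply/measurable_EFinP.
  exact: measurable_normal_pdf.
have f0 x : (0 <= (`|x - c| * phi x)%:E)%E.
  by rewrite lee_fin mulr_ge0 ?normal_pdf_ge0.
under eq_integral do rewrite -EFinM.
rewrite -(setUv (`[c, +oo[ : set R)) ge0_integral_setU//=; last 3 first.
- exact: measurableC.
- by rewrite setUv.
- exact/disj_setPCl.
(* The complement is open at [c]; adding this null endpoint gives the closed half-line needed for
   the reflection. *)
rewrite setCitvr integral_itv_bndo_bndc; last exact: measurable_funTS.
have -> : (\int[mu]_(x in `[c, +oo[) (`|x - c| * phi x)%:E =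
    (phi c - c * (1 - Phi c))%:E)%E.
  rewrite -integral_normal_pdf01_pos_part; apply: eq_integral => x.
  by rewrite inE/= in_itv/= andbT => cx; rewrite ger0_norm ?subr_ge0.
have -> : (\int[mu]_(x in `]-oo, c]) (`|x - c| * phi x)%:E =
    (phi (- c) - (- c) * (1 - Phi (- c)))%:E)%E.
  rewrite -[in `]-oo, _]](opprK c) ge0_integration_by_substitutionNy.
  - rewrite -integral_normal_pdf01_pos_part; apply: eq_integral => x.
    rewrite inE/= in_itv/= andbT => cx; rewrite normal_pdf01N.
    by rewrite ler0_norm ?opprD ?opprK//; lra.
  - apply: continuous_subspaceT => x; apply: cvgM; last exact: continuous_phi.
    by apply: cvg_norm; apply: cvgB; [exact: cvg_id|exact: cvg_cst].
  - by move=> x _; rewrite mulr_ge0 ?normal_pdf_ge0.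
by rewrite -EFinD normal_pdf01N PhiN; congr EFin; ring.
Qed.

Lemma integral_normal_prob01_abs_le1 : (\int[nu]_x `|x|%:E <= 1)%E.
Proof.
under eq_integral do rewrite -[X in `|X|]subr0.
rewrite integral_normal_prob01_dist mul0r addr0 lee_fin normal_pdf01E.
rewrite expr0n mul0r oppr0 expR0 mulr1 ler_pdivrMr ?mul1r; last first.
  by rewrite sqrtr_gt0 mulr_gt0 ?pi_gt0.
(* Writing [2] as the square root of [2 ^+ 2] reduces the claim to [4 <= 2 * pi]. *)
rewrite -{1}(ger0_norm (ler0n R 2)) -sqrtr_sqr ler_wsqrtr//.
by have := @pi_ge2 R; lra.
Qed.

(** Factoring out [s] gives [s] times the distance from [x] to [- m / s], so this is
    [integral_normal_prob01_dist] rescaled. *)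
Lemma integral_normal_prob01_affine m s : 0 < s ->
  (\int[nu]_x `|m + s * x|%:E =
   (Num.sqrt (2 / pi) * s * expR (- m ^+ 2 / (2 * s ^+ 2))
    + m * (1 - 2 * Phi (- m / s)))%:E)%E.
Proof.
move=> s0.
have sqrt2pi : 2 * (Num.sqrt (2 * pi))^-1 = Num.sqrt (2 / pi) :> R.
  apply: (@pexpIrn _ 2) => //; rewrite ?nnegrE ?mulr_ge0 ?sqrtr_ge0 ?invr_ge0//.
  have pi0 := pi_gt0 R.
  rewrite exprMn exprVn !sqr_sqrtr ?mulr_ge0 ?invr_ge0 ?ltW//.
  by move: pi pi0 => p p0; field; rewrite gt_eqF//.
have E x : `|m + s * x|%:E = (s%:E * `|x - (- m / s)|%:E)%E.
  rewrite -EFinM -{2}(gtr0_norm s0) -normrM; congr (`|_|%:E).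
  by field; rewrite gt_eqF//.
under eq_integral do rewrite E.
rewrite ge0_integralZl//; last 2 first.
- by apply/measurable_EFinP; apply: measurableT_comp => //;
    exact: measurable_funB.
- by rewrite lee_fin ltW.
rewrite integral_normal_prob01_dist -EFinM normal_pdf01E mulrA sqrt2pi.
congr EFin; set e1 := expR _; set e2 := expR _.
have -> : e1 = e2 by congr expR; field; rewrite gt_eqF//.
by field; rewrite gt_eqF//.
Qed.

(** Realises every Gaussian on the single space carrying [nu], which makes the coupling possible.
    The degenerate case [s = 0] is included because [sig_eps] may vanish, for instance when
    [theta = 0]. *)
Lemma gauss_cdfE m s : 0 <= s ->
  gauss_cdf m s = cdf_of nu (fun z => m + s * z).
Proof.
rewrite le_eqVlt => /predU1P[<-|s0]; apply/funext => x; rewrite /gauss_cdf.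
  rewrite ltxx (_ : (fun _ => _) = cst m).
    by rewrite cdf_of_cst; case: (m <= x).
  by apply/funext => z; rewrite mul0r addr0.
rewrite s0 /Phi /cdf_of; congr (fine (nu _)).
by apply/seteqP; split => z /=; rewrite !in_itv/= ler_pdivlMr// mulrC lerBrDl.
Qed.

Lemma wasserstein1_gauss_cdf m s m' s' : 0 <= s -> 0 <= s' ->
  (wasserstein1 (gauss_cdf m s) (gauss_cdf m' s') <=
    (`|m - m'| + `|s - s'|)%:E)%E.
Proof.
move=> s0 s'0; rewrite !gauss_cdfE//.
have maff (a b : R) : measurable_fun setT (fun z : R => a + b * z).
  by apply: measurable_funD => //; exact: measurable_funM.
apply: le_trans (wasserstein1_coupling nu (maff _ _) (maff _ _)) _.
have mabs : measurable_fun setT (fun z : R => `|z|%:E).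
  by apply/measurable_EFinP; exact: normr_measurable.
apply: (@le_trans _ _ (\int[nu]_z (`|m - m'|%:E + `|s - s'|%:E * `|z|%:E)%E)%E).
  apply: ge0_le_integral => //=.
  - apply/measurable_EFinP; apply: measurableT_comp => //.
    by apply: measurable_funB; exact: maff.
  - by apply: emeasurable_funD => //; exact: emeasurable_funM.
  - move=> z _; rewrite -EFinM -EFinD lee_fin -normrM.
    rewrite (_ : m + s * z - _ = (m - m') + (s - s') * z) ?ler_normD//; ring.
rewrite ge0_integralD//; last exact: emeasurable_funM.
rewrite integral_cst//= [X in (_ * X)%E](_ : _ = 1%E) ?mule1;
  last exact: (@probability_setT _ _ _ nu).
rewrite EFinD leeD2l//.
rewrite ge0_integralZl//.
by rewrite -[leRHS]mule1 lee_wpmul2l// ?lee_fin//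
  integral_normal_prob01_abs_le1.
Qed.

End standard_normal.

Lemma measurable_gauss_cdf (R : realType) (m s : R) : 0 <= s ->
  measurable_fun setT (gauss_cdf m s).
Proof.
move=> s0; rewrite gauss_cdfE//; apply: measurable_cdf_of.
by apply: measurable_funD => //; exact: measurable_funM.
Qed.

(** Expresses the first absolute moment through the CDF alone, so that the mixture form of the CDF
    of [Y] can be exploited by convexity. *)
Lemma expectation_abs_wasserstein1 d (T : measurableType d) (R : realType)
    (P : probability T R) (Y : T -> R) : measurable_fun setT Y ->
  'E_P[fun w => `|Y w|%R]%E = wasserstein1 (cdf_of P Y) (cdf_of P (cst 0)).
Proof.
move=> mY; rewrite wasserstein1_cst// unlock; apply: eq_integral => w _.
by rewrite subr0.
Qed.

(** * Product with an independent Bernoulli variable *)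

Section bernoulli_product.
Context d (T : measurableType d) (R : realType) (P : probability T R).
Variables (theta : R) (X Y : {RV P >-> R}).
Hypothesis PX1 : P (X @^-1` [set 1]) = theta%:E.
Hypothesis PX0 : P (X @^-1` [set 0]) = (1 - theta)%:E.
Hypothesis XY_indep : forall A B : set R, measurable A -> measurable B ->
  P (X @^-1` A `&` Y @^-1` B) = (P (X @^-1` A) * P (Y @^-1` B))%E.

(** Conditioning on [X]: where [X] is [1] the product is [Y], and independence factors the
    probability; where [X] is [0] the product is the constant [0]. *)
Lemma cdf_of_bernoulli_mul x : cdf_of P (fun w => X w * Y w) x =
  theta * cdf_of P Y x + (1 - theta) * (0 <= x)%R%:R.
Proof.
have mpre (Z : {RV P >-> R}) (A : set R) :
  measurable A -> measurable (Z @^-1` A).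
  by move=> mA; rewrite -[X in measurable X]setTI; exact: measurable_funPT.
have mXY : measurable_fun setT (fun w => X w * Y w).
  by apply: measurable_funM; exact: measurable_funPT.
have mS : measurable ((fun w => X w * Y w) @^-1` `]-oo, x]).
  exact: measurable_preimage_itvNyc.
set S := _ @^-1` _ in mS *.
pose X1 := X @^-1` [set 1]; pose X0 := X @^-1` [set 0].
have mX1 : measurable X1 by exact: mpre.
have mX0 : measurable X0 by exact: mpre.
have dX : X1 `&` X0 = set0.
  by apply/seteqP; split => // w [X1w X0w]; have := oner_neq0 R;
    rewrite -(X1w : X w = 1) (X0w : X w = 0) eqxx.
(* The masses [theta] and [1 - theta] add up to one, so [X] takes other values only on a null
   set. *)
have PN : P (~` (X1 `|` X0)) = 0%E.
  rewrite probability_setC//; last exact: measurableU.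
  rewrite measureU//= -/X1 -/X0 PX1 PX0 -EFinD.
  by rewrite [theta + _]addrC subrK subrr.
have PSE : P S = (P (S `&` X1) + P (S `&` X0))%E.
  rewrite -measureU; [|exact: measurableI|exact: measurableI|]; last first.
    by rewrite setIACA dX setI0.
  rewrite -setIUr (measureDI P mS (measurableU _ _ mX1 mX0)).
  rewrite [X in (X + _)%E](_ : _ = 0%E) ?add0e//.
  apply: (@subset_measure0 _ _ _ _ _ (~` (X1 `|` X0))) => //.
  - by apply: measurableD => //; exact: measurableU.
  - by apply: measurableC; exact: measurableU.
have S1 : P (S `&` X1) = (theta * cdf_of P Y x)%:E.
  have -> : S `&` X1 = X @^-1` [set 1] `&` Y @^-1` `]-oo, x].
    apply/seteqP; split => w /=.
      move=> [Sw X1w]; split => //.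
      by move: Sw; rewrite /S /= (X1w : X w = 1) mul1r.
    by move=> [X1w Yw]; split => //; rewrite /S /= X1w mul1r.
  by rewrite XY_indep// PX1 EFinM /cdf_of fineK// fin_num_measure//;
    exact: mpre.
have S0 : P (S `&` X0) = ((1 - theta) * (0 <= x)%R%:R)%:E.
  have [x0|x0] := leP 0 x.
    rewrite mulr1 -PX0; congr (P _); apply/seteqP; split => [w []//|w X0w].
    by split => //; rewrite /S /= in_itv/= (X0w : X w = 0) mul0r.
  rewrite mulr0 (_ : S `&` X0 = set0) ?measure0//.
  apply/seteqP; split => // w [] + X0w.
  by rewrite /S /= in_itv/= (X0w : X w = 0) mul0r leNgt x0.
by rewrite /cdf_of -/S PSE S1 S0.
Qed.

Lemma wasserstein1_bernoulli_mul : theta <= 1 ->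
  wasserstein1 (cdf_of P (fun w => X w * Y w)) (cdf_of P Y) =
  ((1 - theta)%:E * 'E_P[fun w => `|Y w|%R])%E.
Proof.
move=> theta1; have mY : measurable_fun setT Y by exact: measurable_funPT.
rewrite expectation_abs_wasserstein1//.
rewrite /wasserstein1 -ge0_integralZl//; last 2 first.
- apply: measurable_integrand_wasserstein; exact: measurable_cdf_of.
- by rewrite lee_fin subr_ge0.
apply: eq_integral => x _; rewrite cdf_of_bernoulli_mul cdf_of_cst.
rewrite -EFinM distrC -[in RHS](@ger0_norm _ (1 - theta)) ?subr_ge0// -normrM.
by congr (`|_|%:E); ring.
Qed.

End bernoulli_product.

Unset Implicit Arguments.

Theorem theorem3 (R : realType) (d : measure_display) (T : measurableType d)
  (P : probability T R) (theta : R) (N : nat) (a mu_ sig : 'I_N -> R)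
  (X Y Eb : {RV P >-> R}) (M : nat) :
  0 <= theta <= 1 ->
  (forall l, 0 <= a l) -> \sum_(l < N) a l = 1 -> (forall l, 0 < sig l) ->
  (forall x, cdf_of P Y x = \sum_(l < N) a l * Phi ((x - mu_ l) / sig l)) ->
  P (X @^-1` [set 1]) = theta%:E ->
  P (X @^-1` [set 0]) = (1 - theta)%:E ->
  (forall A B : set R, measurable A -> measurable B ->
     P (X @^-1` A `&` Y @^-1` B) = (P (X @^-1` A) * P (Y @^-1` B))%E) ->
  (0 < M)%N ->
  let mu := \sum_(l < N) a l * mu_ l in
  let sigma := Num.sqrt (fine 'V_P[Y]) in
  let sig_eps := Num.sqrt (theta * sigma ^+ 2 + (1 - theta) * theta * mu ^+ 2) in
  (forall x, cdf_of P Eb x = gauss_cdf (theta * mu) (sig_eps / Num.sqrt M%:R) x) ->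
  (wasserstein1 (cdf_of P (fun w => (X w * Y w)%R)) (cdf_of P Eb) <=
     (1 - theta)%:E * 'E_P[fun w => `|Y w|%R] +
     (\sum_(l < N) a l * (`|theta * mu - mu_ l|
                          + `|sig_eps / Num.sqrt M%:R - sig l|))%:E)%E /\
  ('E_P[fun w => `|Y w|%R] <=
     (\sum_(l < N) (Num.sqrt (2 / pi) * sig l
                      * expR (- mu_ l ^+ 2 / (2 * sig l ^+ 2))
                    + mu_ l * (1 - 2 * Phi (- mu_ l / sig l))))%:E)%E.
Proof.
move=> /andP[theta0 theta1] a0 a1 sig0 FY PX1 PX0 indep M0 mu sigma sig_eps FEb.
set s := sig_eps / Num.sqrt M%:R.
have s0 : 0 <= s by rewrite divr_ge0 ?sqrtr_ge0.
have mY : measurable_fun setT Y by exact: measurable_funPT.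
have FYE : cdf_of P Y = fun x => \sum_(l < N) a l * gauss_cdf (mu_ l) (sig l) x.
  apply/funext => x; rewrite FY; apply: eq_bigr => l _.
  by rewrite /gauss_cdf sig0.
have mG m' s' : 0 <= s' -> measurable_fun setT (gauss_cdf m' s').
  by move=> ?; exact: measurable_gauss_cdf.
have sig_ge0 l : 0 <= sig l by exact: ltW.
split.
- have mXY : measurable_fun setT (fun w => X w * Y w).
    by apply: measurable_funM; exact: measurable_funPT.
  have mcY : measurable_fun setT (cdf_of P Y) by exact: measurable_cdf_of.
  have -> : cdf_of P Eb = gauss_cdf (theta * mu) s by exact/funext.
  (* The CDF of [Y] is the intermediate point: the first leg is the Bernoulli term, the second is
     bounded component by component. *)
  apply: le_trans.
    by apply: (@wasserstein1_triangle _ _ (cdf_of P Y));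
      [exact: measurable_cdf_of| |exact: mG].
  rewrite (wasserstein1_bernoulli_mul PX1 PX0 indep)// leeD2l// FYE.
  apply: le_trans.
    by apply: wasserstein1_mixture => // [l|]; exact: mG.
  rewrite -sumEFin; apply: lee_sum => l _.
  rewrite EFinM lee_wpmul2l ?lee_fin//.
  apply: le_trans; first exact: wasserstein1_gauss_cdf.
  by rewrite lee_fin (distrC (mu_ l)) (distrC (sig l)).
- rewrite expectation_abs_wasserstein1// FYE; apply: le_trans.
    apply: wasserstein1_mixture => // [l|]; first exact: mG.
    exact: measurable_cdf_of.
  rewrite -sumEFin; apply: lee_sum => l _.
  (* The point mass at [0] has the same CDF on every probability space; moving it to that of [nu]
     lets [wasserstein1_cst] apply to [m + s * z]. *)
  have -> : cdf_of P (cst 0) = cdf_of (@normal_prob R 0 1) (cst 0).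
    by apply/funext => x; rewrite !cdf_of_cst.
  rewrite gauss_cdfE// wasserstein1_cst; last first.
    by apply: measurable_funD => //; exact: measurable_funM.
  under eq_integral do rewrite subr0.
  rewrite -integral_normal_prob01_affine//.
  (* Each component moment is nonnegative, so its weight can be replaced by [1], an upper bound
     since the other weights are nonnegative and all sum to one. *)
  rewrite -[leRHS]mul1e lee_wpmul2r ?integral_ge0// lee_fin.
  by rewrite -a1 (bigD1 l)//= lerDl sumr_ge0.
Qed.
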